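(* There is a universal constant $c$ such that the following holds. Let $A_1,\dots,A_n$ ($n\ge 2$) be agents whose EPR graph $G=(V,E)$ is a spanning EPR tree. Then the $n$-partite maximally entangled state $(|00\cdots 0\rangle+|11\cdots 1\rangle)/\sqrt{2}$ can be prepared amongst the $n$ agents (one qubit held by each agent) by a protocol using only local operations and at most $c\,n$ bits of classical communication, i.e. with $O(n)$ bits of classical communication.
   Context: The EPR graph of $n$ agents $A_1,\dots,A_n$ is the undirected graph $G=(V,E)$ with $V=\{A_1,\dots,A_n\}$ and $\{A_i,A_j\}\in E$ ($i\ne j$) if and only if $A_i$ and $A_j$ share an EPR pair, i.e. each holds one qubit of a two-qubit system in the state $(|00\rangle+|11\rangle)/\sqrt{2}$. A spanning EPR tree is an EPR graph that is a tree on the whole vertex set $V$ (connected and acyclic). The initial joint state is the tensor product over the edges of $G$ of these EPR pairs, together with local ancilla qubits in state $|0\rangle$. Local operations: each agent may adjoin ancillas, apply unitaries and perform measurements on the qubits it holds, conditioned on earlier outcomes and on received classical bits. There is no quantum communication after the EPR pairs have been distributed. Broadcasting one classical bit to the other agents counts as one bit of classical communication. The state is ''prepared'' if, for every sequence of measurement outcomes, at the end $n$ designated qubits, one per agent, are in the stated state (up to global phase, in tensor product with the remaining qubits). *)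

(* Defs.v *)
From HB Require Import structures.
From mathcomp Require Import all_boot all_order all_algebra.
From mathcomp Require Import sesquilinear spectral.

Set Implicit Arguments.
Unset Strict Implicit.
Unset Printing Implicit Defensive.

Import GRing.Theory Num.Theory.
Local Open Scope ring_scope.
Local Open Scope sesquilinear_scope.

Definition acyclic (T : finType) (e : rel T) : Prop :=
  forall c : seq T, (2 < size c)%N -> ~ ucycle e c.

Definition is_tree (T : finType) (e : rel T) : Prop :=
  [/\ symmetric e, irreflexive e,
      forall x y : T, connect e x y & acyclic e].

(* Computational basis states of a register of qubits indexed by Q. *)
Definition cfg (Q : finType) : finType := {ffun Q -> bool}.

Definition restr (Q : finType) (A : pred Q) (s : cfg Q) : cfg {q : Q | A q} :=
  [ffun q => s (val q)].

(* s with its A-part replaced by t *)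
Definition overwrite (Q : finType) (A : pred Q) (s : cfg Q)
    (t : cfg {q : Q | A q}) : cfg Q :=
  [ffun q => if insub q is Some q' then t q' else s q].

Section Quantum.
Variable C : numClosedFieldType.

(* A state is given by its amplitudes in the computational basis. *)
Definition state (Q : finType) := {ffun cfg Q -> C}.

Definition norm2 (Q : finType) (psi : state Q) : C :=
  sqrtC (\sum_s `|psi s| ^+ 2).

Definition normalize (Q : finType) (psi : state Q) : state Q :=
  [ffun s => psi s / norm2 psi].

(* Operators on the register {q | A q}; basis states are matrix indices via
   enum_rank. *)
Definition loperator (Q : finType) (A : pred Q) :=
  'M[C]_#|cfg {q : Q | A q}|.

(* (U (x) identity on the qubits outside A) psi *)
Definition lapply (Q : finType) (A : pred Q) (U : loperator A)
    (psi : state Q) : state Q :=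
  [ffun s => \sum_(t : cfg {q : Q | A q})
     U (enum_rank (restr A s)) (enum_rank t) * psi (overwrite s t)].

Record unitary (N : nat) := Unitary {
  unitary_mx :> 'M[C]_N;
  unitary_mxP : unitary_mx \is unitarymx }.

Record measurement (N : nat) := Measurement {
  outcomes : nat;
  kraus : 'I_outcomes -> 'M[C]_N;
  krausP : \sum_k (kraus k)^t* *m kraus k = 1%:M }.

Section Protocol.
Variables (n : nat) (Q : finType) (own : Q -> 'I_n).

Definition held_by (i : 'I_n) : pred Q := [pred q | own q == i].

Definition ldim (i : 'I_n) : nat := #|cfg {q : Q | held_by i q}|.

(* The position reached in the protocol tree is exactly the transcript of the
   bits broadcast so far, which all agents know.  Measurement outcomes are
   private and do not branch the tree: an agent acts according to the node and
   to the list of its own earlier outcomes only. *)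
Inductive protocol : Type :=
  | Halt
  | Apply (i : 'I_n) (U : seq nat -> unitary (ldim i)) (P : protocol)
  | Measure (i : 'I_n) (M : seq nat -> measurement (ldim i)) (P : protocol)
  | Broadcast (i : 'I_n) (b : seq nat -> bool) (P : bool -> protocol).

(* number of broadcast bits, in the worst case *)
Fixpoint comm_cost (P : protocol) : nat :=
  match P with
  | Halt => 0
  | Apply _ _ P' => comm_cost P'
  | Measure _ _ P' => comm_cost P'
  | Broadcast _ _ P' => (maxn (comm_cost (P' false)) (comm_cost (P' true))).+1
  end.

(* reaches P H psi psi': psi' is the final state for some sequence of
   outcomes of nonzero probability, when P is run from psi and H i is the list
   of outcomes obtained so far by agent i. *)
Fixpoint reaches (P : protocol) (H : 'I_n -> seq nat)
    (psi psi' : state Q) : Prop :=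
  match P with
  | Halt => psi' = psi
  | Apply i U P' => reaches P' H (@lapply Q (held_by i) (U (H i)) psi) psi'
  | Measure i M P' =>
      exists k : 'I_(outcomes (M (H i))),
        let phi := @lapply Q (held_by i) (kraus k) psi in
        phi <> 0 /\
        reaches P' [eta H with i |-> rcons (H i) (k : nat)]
                (normalize phi) psi'
  | Broadcast i b P' => reaches (P' (b (H i))) H psi psi'
  end.

End Protocol.

(* (|0...0> + |1...1>) / sqrt 2 on the qubits Q *)
Definition cat_state (Q : finType) : state Q :=
  [ffun s => ((s == [ffun=> false])%:R + (s == [ffun=> true])%:R) / sqrtC 2].

(* psi = cat_state (x) phi, the first factor being on the qubits out i.  For
   a unit vector psi, phi is a unit vector too; it absorbs the global phase. *)
Definition shares_cat_state (n : nat) (Q : finType) (out : 'I_n -> Q)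
    (psi : state Q) : Prop :=
  exists phi : state {q : Q | q \notin codom out},
    forall s : cfg Q,
      psi s = cat_state 'I_n [ffun i => s (out i)]
              * phi (restr [pred q | q \notin codom out] s).

Section Resources.
Variables (n : nat) (e : rel 'I_n) (anc : 'I_n -> nat).

(* The half (i, j) of the pair shared along {i, j} is held by i; moreover each
   agent i holds anc i ancillas. *)
Definition half_edge : finType := {h : 'I_n * 'I_n | e h.1 h.2}.
Definition ancilla : finType := {i : 'I_n & 'I_(anc i)}.
Definition qubit : finType := (half_edge + ancilla)%type.

Definition owner (q : qubit) : 'I_n :=
  match q with inl h => (val h).1 | inr a => tag a end.

(* amplitude of |ab> in (|00> + |11>) / sqrt 2 *)
Definition epr (a b : bool) : C :=
  ((~~ a && ~~ b)%:R + (a && b)%:R) / sqrtC 2.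

(* One EPR pair per edge {i, j}, listed once with i < j. *)
Definition init_state : state qubit :=
  [ffun s : cfg qubit =>
     (\prod_(h : half_edge | ((val h).1 < (val h).2)%N)
        \prod_(h' : half_edge | val h' == ((val h).2, (val h).1))
           epr (s (inl h)) (s (inl h')))
     * \prod_(a : ancilla) (~~ s (inr a))%:R].

End Resources.
End Quantum.

(* Main.v *)
(** No ancillas are needed.  Each agent picks a reference qubit among its half
edges; for every half edge its owner measures the parity with the reference
qubit and broadcasts the outcome.  All states that occur are uniform
superpositions of basis states, supported after the measurements on the
configurations that agree along edges and have the announced parities.  By
connectivity this support is [{s0, ~ s0}] for any [s0] in it, so once [s0] is
known to everybody each agent can, by a permutation of its basis states, flip
its qubits according to [s0] and then xor the reference qubit into its other
qubits: the reference qubits end up in the cat state and the others in [|0>].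
One bit is sent per half edge, and an acyclic graph has at most [2 n] half
edges because deleting a vertex of degree at most one removes at most two. *)
Require Import Defs.
From mathcomp Require Import all_boot all_order all_algebra.
From mathcomp Require Import sesquilinear spectral.
From mathcomp Require Import reals complex.

Set Implicit Arguments.
Unset Strict Implicit.
Unset Printing Implicit Defensive.

Import GRing.Theory Num.Theory.
Local Open Scope ring_scope.
Local Open Scope sesquilinear_scope.

(** * Acyclic graphs: leaves and the number of edges *)

Section Forest.
Variables (T : finType) (e : rel T).
Hypotheses (e_sym : symmetric e) (e_irr : irreflexive e) (e_acyc : acyclic e).

(** Otherwise a simple path with head in [A] could be prolonged at its head forever, since running
    back into itself would close a cycle. *)
Lemma acyclic_leaf (A : {set T}) :
  A != set0 -> exists2 x, x \in A & (#|[set y in A | e x y]| <= 1)%N.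
Proof.
case/set0Pn=> x0 x0A.
have [[x xA leaf_x]|no_leaf] :
  (exists2 x, x \in A & (#|[set y in A | e x y]| <= 1)%N) \/
  (forall x, x \in A -> (1 < #|[set y in A | e x y]|)%N).
- case: (boolP [exists x in A, (#|[set y in A | e x y]| <= 1)%N]) => [/exists_inP|].
    by left.
  by rewrite negb_exists_in => /forall_inP h; right=> x /h; rewrite -ltnNge.
- by exists x.
have long k : exists x s,
    [/\ path e x s, uniq (x :: s), x \in A & size s = k].
  elim: k => [|k [x [s [es us xA szs]]]]; first by exists x0, [::].
  (* Of the two or more neighbours of [x] in [A], one survives the removal of the second vertex of
     the path (of [x] itself when [s] is empty). *)
  have [y] : exists y, y \in [set y in A | e x y] :\ head x s.
    apply/set0Pn; rewrite -card_gt0.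
    have := no_leaf x xA; rewrite (cardsD1 (head x s)).
    by case: (_ \in _); case: #|_|.
  rewrite !inE => /and3P[ynh yA exy].
  exists y, (x :: s); split=> //=; last by rewrite szs.
    by rewrite e_sym exy.
  rewrite -[_ && uniq s]/(uniq (x :: s)) us andbT inE negb_or.
  apply/andP; split; first by apply: contraTneq exy => ->; rewrite e_irr.
  apply/negP => /splitPr sE; case: sE es us ynh => s1 s2 es us ynh.
  (* [y] is not the second vertex, so [s1] is nonempty and the cycle has at least three vertices. *)
  case: s1 es us ynh => [|z s1] es us ynh; first by rewrite /= eqxx in ynh.
  apply: (e_acyc (c := x :: rcons (z :: s1) y)).
    by rewrite /= size_rcons.
  apply/andP; split.
    rewrite /cycle rcons_path last_rcons e_sym exy andbT.
    by move: es; rewrite -cat_rcons cat_path => /andP[].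
  by move: us; rewrite -cat_rcons -cat_cons cat_uniq => /andP[].
have [x [s [_ us _ szs]]] := long #|T|.
by have := uniq_leq_size us (fun y _ => mem_enum T y); rewrite -cardE /= szs ltnn.
Qed.

Lemma acyclic_card (A : {set T}) :
  (#|[set p : T * T | [&& p.1 \in A, p.2 \in A & e p.1 p.2]]| <= 2 * #|A|)%N.
Proof.
move Dk: #|A| => k; elim: k A Dk => [|k IHk] A cardA.
  rewrite (cards0_eq cardA) leqn0 cards_eq0; apply/eqP/setP => p.
  by rewrite !inE.
have /acyclic_leaf[x xA leaf_x] : A != set0 by rewrite -card_gt0 cardA.
have cardAx : #|A :\ x| = k by move: cardA; rewrite (cardsD1 x) xA => -[].
have := IHk _ cardAx; set B := [set p | _] => leB.
set N := [set y in A | e x y] in leaf_x.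
(* A pair inside [A] avoids [x] or is [(x, y)] or [(y, x)] with [y] in [N], which has at most one
   element. *)
apply: leq_trans (_ : #|B :|: (pair x @: N :|: (fun y => (y, x)) @: N)| <= _)%N.
  apply/subset_leq_card/subsetP=> -[y z]; rewrite !inE /= => /and3P[yA zA eyz].
  rewrite yA zA eyz !andbT.
  have [yx|] := eqVneq y x.
    by rewrite yx (imset_f (pair x)) ?orbT // inE zA -yx.
  have [zx|//] := eqVneq z x => _ /=.
  by rewrite zx (imset_f (fun y => (y, x))) ?orbT // inE yA e_sym -zx.
rewrite mulnS addnC.
apply: leq_trans (leq_card_setU _ _) (leq_add leB _).
apply: leq_trans (leq_card_setU _ _) _.
by rewrite (leq_add (n1 := 1) (n2 := 1)) //;
   apply: leq_trans (leq_imset_card _ _) leaf_x.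
Qed.

Lemma acyclic_card_edges :
  (#|[pred p : T * T | e p.1 p.2]| <= 2 * #|T|)%N.
Proof.
rewrite -cardsT; apply: leq_trans (acyclic_card setT).
by apply/subset_leq_card/subsetP=> p; rewrite !inE.
Qed.

End Forest.

(** * Monomial operators on part of the register *)

Section LocalOperators.
Variables (C : numClosedFieldType) (Q : finType) (A : pred Q).
Notation lcfg := (cfg {q : Q | A q}).

Lemma overwrite_restr (s : cfg Q) : overwrite s (restr A s) = s.
Proof. by apply/ffunP=> q; rewrite ffunE; case: insubP => //= u _ <-; rewrite ffunE. Qed.

(** Such an operator pulls amplitudes back along [g] and scales them by [c]; this covers both
    permutations and diagonal projectors. *)
Definition monomial_op (c : lcfg -> C) (g : lcfg -> lcfg) : loperator C A :=
  \matrix_(i, j) (c (enum_val i) * (g (enum_val i) == enum_val j)%:R).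

Lemma lapply_monomial c g (psi : state C Q) s :
  lapply (monomial_op c g) psi s =
  c (restr A s) * psi (overwrite s (g (restr A s))).
Proof.
rewrite ffunE (bigD1 (g (restr A s))) //= big1 ?addr0 => [|t /negPf tn].
  by rewrite mxE !enum_rankK eqxx mulr1.
by rewrite mxE !enum_rankK eq_sym tn mulr0 mul0r.
Qed.

Lemma perm_unitary (g : lcfg -> lcfg) :
  injective g -> monomial_op (fun=> 1) g \is unitarymx.
Proof.
move=> g_inj; apply/unitarymxP/matrixP=> i j; rewrite !mxE.
rewrite (bigD1 (enum_rank (g (enum_val i)))) //= big1 ?addr0 => [|k].
  rewrite !mxE enum_rankK eqxx !mul1r conjC_nat (inj_eq g_inj).
  by rewrite (inj_eq enum_val_inj) eq_sym.
rewrite !mxE -(inj_eq enum_val_inj) enum_rankK eq_sym => /negPf ->.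
by rewrite mulr0 mul0r.
Qed.

Definition parity_kraus (p : lcfg -> bool) (k : 'I_2) : loperator C A :=
  monomial_op (fun t => (p t == (k == 1 :> nat))%:R) id.

Lemma parity_krausP (p : lcfg -> bool) :
  \sum_k (parity_kraus p k)^t* *m parity_kraus p k = 1%:M.
Proof.
apply/matrixP=> i j; rewrite summxE.
under eq_bigr => k _.
  rewrite mxE (bigD1 i) //= big1 ?addr0 => [|l /negPf li].
    rewrite !mxE eqxx mulr1 conjC_nat mulrA -natrM mulnb andbb
      (inj_eq enum_val_inj); over.
  by rewrite !mxE (inj_eq enum_val_inj) li mulr0 conjC0 mul0r.
(* Both projectors are diagonal, and exactly one of them has entry 1 at [i]. *)
rewrite big_ord_recl big_ord1 -mulrDl mxE -natrD.
by case: (p _); rewrite mul1r.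
Qed.

Definition parity_measurement (p : lcfg -> bool) : measurement C #|lcfg| :=
  Measurement (parity_krausP p).

Definition perm_op (g : lcfg -> lcfg) (g_inj : injective g) :
  unitary C #|lcfg| := Unitary (perm_unitary g_inj).

End LocalOperators.

(** * The parity-merging protocol *)

Section ParityMerging.
Variables (C : numClosedFieldType) (n : nat) (Q : finType) (own : Q -> 'I_n).
Variables (ref : 'I_n -> Q) (own_ref : forall i, own (ref i) = i).

(* [E] stands for the support of the initial state: both halves of each pair
   agree. *)
Variable E : pred (cfg Q).

Definition parity (q : Q) (s : cfg Q) : bool := s q (+) s (ref (own q)).

Definition consistent (tr : seq (Q * bool)) (s : cfg Q) : bool :=
  all (fun qb => parity qb.1 s == qb.2) tr.

Definition ref_sub (i : 'I_n) : {q | held_by own i q} :=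
  exist _ (ref i) (introT eqP (own_ref i)).

Definition local_parity (q : Q) (t : cfg {q' | held_by own (own q) q'}) : bool :=
  t (exist _ q (eqxx (own q))) (+) t (ref_sub (own q)).

Lemma local_parity_restr q s :
  local_parity (restr (held_by own (own q)) s) = parity q s.
Proof. by rewrite /local_parity !ffunE. Qed.

(** Since operators pull back, this is the inverse of the physical correction: first xor the
    reference bit into the others, then flip by [s0]. *)
Definition local_fix (s0 : cfg Q) (i : 'I_n) (t : cfg {q | held_by own i q}) :
    cfg {q | held_by own i q} :=
  [ffun u => t u (+) ((val u != ref i) && t (ref_sub i)) (+) s0 (val u)].

Lemma local_fix_inj s0 i : injective (@local_fix s0 i).
Proof.
(* The reference bit, only shifted by [s0], is recovered first; the others follow. *)
move=> t t' /ffunP eq_tt'; have tr : t (ref_sub i) = t' (ref_sub i).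
  by have := eq_tt' (ref_sub i); rewrite !ffunE /= eqxx !addbF => /addIb.
by apply/ffunP=> u; have := eq_tt' u; rewrite !ffunE tr => /addIb/addIb.
Qed.

Definition fix_on (s0 : cfg Q) (l : seq 'I_n) (s : cfg Q) : cfg Q :=
  [ffun q => if own q \in l
             then s q (+) ((q != ref (own q)) && s (ref (own q))) (+) s0 q
             else s q].

Fixpoint correction (s0 : cfg Q) (l : seq 'I_n) : protocol C own :=
  if l is i :: l' then
    Apply (fun _ => perm_op C (@local_fix_inj s0 i)) (correction s0 l')
  else Halt C own.

(** [s0] depends only on the announced parities [tr], so all agents correct by the same
    configuration. *)
Fixpoint merging (l : seq Q) (tr : seq (Q * bool)) : protocol C own :=
  if l is q :: l' then
    Measure (i := own q) (fun _ => parity_measurement C (@local_parity q))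
      (Broadcast (own q) (fun H => last 0%N H == 1%N)
        (fun b => merging l' ((q, b) :: tr)))
  else if [pick s | E s && consistent tr s] is Some s0 then correction s0 (enum 'I_n)
  else Halt C own.

Lemma correction_cost s0 l : comm_cost (correction s0 l) = 0%N.
Proof. by elim: l. Qed.

Lemma merging_cost l tr : comm_cost (merging l tr) = size l.
Proof.
elim: l tr => [|q l IHl] tr /=; last by rewrite !IHl maxnn.
by case: pickP => // s0 _; apply: correction_cost.
Qed.

Lemma lapply_fix s0 i (psi : state C Q) s :
  lapply (perm_op C (@local_fix_inj s0 i)) psi s = psi (fix_on s0 [:: i] s).
Proof.
rewrite lapply_monomial mul1r; congr (psi _); apply/ffunP=> q.
rewrite !ffunE inE; case: insubP => [u|] /=.
  by rewrite /held_by /= => /eqP own_q uq; rewrite own_q eqxx !ffunE /= uq.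
by rewrite /held_by /= => /negPf ->.
Qed.

Lemma correction_reaches s0 l H (psi psi' : state C Q) :
  uniq l -> reaches (correction s0 l) H psi psi' ->
  forall s, psi' s = psi (fix_on s0 l s).
Proof.
elim: l psi => [|i l IHl] psi /= => [_ -> s|/andP[il ul] reach s].
  by congr (psi _); apply/ffunP=> q; rewrite ffunE.
rewrite (IHl _ ul reach) lapply_fix; congr (psi _); apply/ffunP=> q.
rewrite !ffunE !inE own_ref.
by have [->|] := eqVneq (own q) i; rewrite ?(negPf il).
Qed.

(** Modulo 2, [E] is a linear space containing the all-one vector; through [E_rigid] the
    connectivity of the graph will enter. *)
Hypotheses (E_add : forall s t, E s -> E t -> E [ffun q => s q (+) t q])
  (E_rigid : forall s, E s -> (forall q, s q = s (ref (own q))) ->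
     forall q q', s q = s q')
  (E_const : forall b, E [ffun=> b]).

(** Members of [E] with the same parities at all qubits differ by a member of [E] that is constant
    on each agent, hence by a constant. In terms of [s], this difference [d] is constant exactly
    when the reference bits agree and all other bits vanish. *)
Lemma merged_support s0 tr s :
    (forall q, q \in map fst tr) -> E s0 -> consistent tr s0 ->
  E (fix_on s0 (enum 'I_n) s) && consistent tr (fix_on s0 (enum 'I_n) s) =
  [forall q, (q != ref (own q)) ==> ~~ s q] &&
  [forall i, forall j, s (ref i) == s (ref j)].
Proof.
move=> tr_full Es0 cs0; set t := fix_on _ _ _.
have tE q : t q = s q (+) ((q != ref (own q)) && s (ref (own q))) (+) s0 q.
  by rewrite ffunE mem_enum.
pose d : cfg Q := [ffun q => t q (+) s0 q].
have dE q : d q = s q (+) ((q != ref (own q)) && s (ref (own q))).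
  by rewrite ffunE tE addbK.
have td : t = [ffun q => d q (+) s0 q].
  by apply/ffunP=> q; rewrite !ffunE addbK.
have dref i : d (ref i) = s (ref i) by rewrite dE own_ref eqxx addbF.
apply/andP/andP=> [[Et ct]|[/forallP s_off /forallP s_ref]].
- have Ed : E d by apply: E_add.
  have d_own q : d q = d (ref (own q)).
    have /mapP[[q' b] qb /= eq_q] := tr_full q; subst q'.
    have := allP ct _ qb; have := allP cs0 _ qb; rewrite /= /parity.
    move=> /eqP<-; rewrite [d q]ffunE [d (ref _)]ffunE.
    by case: (t q) (s0 q) (t (ref _)) (s0 (ref _)) => [] [] [] [].
  have d_const := E_rigid Ed d_own; split.
    apply/forallP=> q; apply/implyP=> q_off.
    have := d_own q; rewrite dref dE q_off /=.
    by case: (s q) (s (ref _)) => [] [].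
  by apply/forallP=> i; apply/forallP=> j; rewrite -!dref (d_const _ (ref j)).
- have d_own q : d q = s (ref (own q)).
    rewrite dE; have := s_off q; have [<- _|_ /= /negPf ->//] := eqVneq q _.
    by rewrite addbF.
  have d_const q q' : d q = d q'.
    by rewrite !d_own; have /forallP/(_ (own q'))/eqP := s_ref (own q).
  have [b db] : exists b, d = [ffun=> b].
    case: (pickP (mem Q)) => [q _|Q0].
      by exists (d q); apply/ffunP=> q'; rewrite [RHS]ffunE.
    by exists true; apply/ffunP=> q; have := Q0 q.
  rewrite td db; split; first by apply: E_add.
  apply/allP=> -[q c] qc; rewrite -(eqP (allP cs0 _ qc)) /parity !ffunE /=.
  by case: b (s0 q) (s0 (ref _)) {db} => [] [] [].
Qed.

Lemma lapply_parity q k (psi : state C Q) s :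
  lapply (parity_kraus C (@local_parity q) k) psi s =
  (parity q s == (k == 1 :> nat))%:R * psi s.
Proof. by rewrite lapply_monomial local_parity_restr overwrite_restr. Qed.

(** Leaving [a] arbitrary, possibly 0, absorbs normalisation, so no norm has to be computed. *)
Definition uniform_on (a : C) (P : pred (cfg Q)) (psi : state C Q) : Prop :=
  forall s, psi s = if P s then a else 0.

Hypothesis n_gt0 : (0 < n)%N.

Lemma uniform_shares_cat a (psi : state C Q) :
  uniform_on a [pred s : cfg Q | [forall q, (q != ref (own q)) ==> ~~ s q] &&
                  [forall i, forall j, s (ref i) == s (ref j)]] psi ->
  shares_cat_state ref psi.
Proof.
move=> psiE.
(* The other qubits are all in state 0; [sqrtC 2] cancels the denominator of [cat_state]. *)
exists [ffun t => a * sqrtC 2 * (t == [ffun=> false])%:R] => s.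
rewrite psiE !ffunE /=.
set rest0 := restr _ _ == _.
have -> : [forall q, (q != ref (own q)) ==> ~~ s q] = rest0.
  apply/forallP/eqP=> [s_off|/ffunP s_off q].
    apply/ffunP=> u; rewrite !ffunE; apply: negbTE.
    have u_out : val u \notin codom ref := valP u.
    have /implyP := s_off (val u); apply; apply: contraNneq u_out => ->.
    exact: codom_f.
  apply/implyP=> q_off; have q_out : q \notin codom ref.
    by apply: contra q_off => /codomP[i ->]; rewrite own_ref.
  by have := s_off (exist _ q q_out); rewrite !ffunE /= => ->.
have -> : [forall i, forall j, s (ref i) == s (ref j)] =
    ([ffun i => s (ref i)] == [ffun=> false] :> cfg 'I_n)
    || ([ffun i => s (ref i)] == [ffun=> true] :> cfg 'I_n).
  apply/forallP/orP=> [s_ref|].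
    have i0 := Ordinal n_gt0; case si0: (s (ref i0)); [right|left];
      apply/eqP/ffunP=> i; rewrite !ffunE -si0;
      by have /forallP/(_ i0)/eqP := s_ref i.
  by move=> s_ref i; apply/forallP=> j; case: s_ref => /eqP/ffunP s_ref;
     have := s_ref i; have := s_ref j; rewrite !ffunE => -> ->.
have [s_f|_] := eqVneq _ [ffun=> false].
  (* As [n] is positive, the all-0 and all-1 words differ and only one term of [cat_state]
     survives. *)
  have -> : ([ffun i => s (ref i)] == [ffun=> true] :> cfg 'I_n) = false.
    by rewrite s_f; apply/eqP=> /ffunP/(_ (Ordinal n_gt0)); rewrite !ffunE.
  rewrite addr0; case: rest0; rewrite ?mulr0 ?mulr1 //= mul1r mulrC mulfK //.
  by rewrite sqrtC_eq0 pnatr_eq0.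
rewrite add0r /=; case: (_ == _); case: rest0; rewrite ?mulr0 ?mul0r //=.
by rewrite mul1r mulr1 mulrC mulfK // sqrtC_eq0 pnatr_eq0.
Qed.

(** Invariant: each measurement cuts the support down to the configurations with the announced
    parity and merely rescales [a]. *)
Lemma merging_reaches l tr H a (psi psi' : state C Q) :
    (forall q, (q \in l) || (q \in map fst tr)) ->
    uniform_on a [pred s | E s && consistent tr s] psi ->
  reaches (merging l tr) H psi psi' -> shares_cat_state ref psi'.
Proof.
elim: l tr H a psi => [|q l IHl] tr H a psi full psiE /=.
  case: pickP => [s0 /andP[Es0 cs0] reach|no_s0 ->].
    have psi'E := correction_reaches (enum_uniq 'I_n) reach.
    apply: (@uniform_shares_cat a) => s.
    by rewrite psi'E psiE /= merged_support.
  (* No configuration fits the transcript, so the state is zero, that is, uniform with amplitude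
     0. *)
  by apply: (@uniform_shares_cat 0) => s; rewrite psiE /= no_s0 if_same.
case=> k [_]; rewrite eqxx last_rcons => /IHl; apply.
  move=> q'; have := full q'; rewrite !inE.
  by case: (q' == q); rewrite ?orbT.
move=> s; rewrite /= ffunE lapply_parity psiE /=.
case: (parity q s == _); rewrite ?mul1r /= ?andbF ?mul0r //.
by case: ifP; rewrite ?mul0r.
Qed.

End ParityMerging.

(** * The support of the EPR pairs *)

Section Pairs.
Variables (C : numClosedFieldType) (n : nat) (e : rel 'I_n).
Notation anc := (fun _ : 'I_n => 0%N).
Notation Q := (qubit e anc).
Notation half h := (inl h : Q).

Definition paired (h h' : half_edge e) : bool :=
  val h' == ((val h).2, (val h).1).

Definition pairs_agree (s : cfg Q) : bool :=
  [forall h, forall h', paired h h' ==> (s (half h) == s (half h'))].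

Lemma pairs_agreeP (s : cfg Q) :
  reflect (forall h h', paired h h' -> s (half h) = s (half h')) (pairs_agree s).
Proof.
apply: (iffP idP) => [/forallP agr h h' hh'|agr].
  by have /forallP/(_ h')/implyP/(_ hh')/eqP := agr h.
by apply/forallP=> h; apply/forallP=> h'; apply/implyP=> /agr ->.
Qed.

Lemma pairs_agree_add (s t : cfg Q) :
  pairs_agree s -> pairs_agree t -> pairs_agree [ffun q => s q (+) t q].
Proof.
move=> /pairs_agreeP agr_s /pairs_agreeP agr_t; apply/pairs_agreeP=> h h' hh'.
by rewrite !ffunE (agr_s _ _ hh') (agr_t _ _ hh').
Qed.

Lemma pairs_agree_const b : pairs_agree [ffun=> b].
Proof. by apply/pairs_agreeP=> h h' _; rewrite !ffunE. Qed.

Lemma eprE a b : epr C a b = (a == b)%:R / sqrtC 2.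
Proof. by case: a b => [] []; rewrite /epr /= ?addr0 ?add0r. Qed.

(** By [eprE] each pair contributes a constant, or 0 if its halves disagree; the ancilla product is
    empty. *)
Lemma init_uniform : irreflexive e ->
  exists a, uniform_on a pairs_agree (init_state C e anc).
Proof.
move=> e_irr.
exists (\prod_(h : half_edge e | ((val h).1 < (val h).2)%N)
          \prod_(h' | paired h h') (sqrtC 2)^-1) => s.
rewrite ffunE [X in _ * X]big1 ?mulr1 => [|[i []] //].
case: pairs_agreeP => [agr|/pairs_agreeP].
  apply: eq_bigr => h _; apply: eq_bigr => h' hh'.
  by rewrite eprE (agr _ _ hh') eqxx mul1r.
rewrite negb_forall => /existsP[h]; rewrite negb_forall => /existsP[h'].
rewrite negb_imply => /andP[hh' neq].
(* The product lists each pair from its smaller end, so the halves may have to be swapped;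
   irreflexivity excludes equal ends. *)
wlog lt_h : h h' hh' neq / ((val h).1 < (val h).2)%N.
  move=> lt_case; case: (ltngtP (val h).1 (val h).2) => [|gt_h|/val_inj eq_h].
  - exact: lt_case hh' neq.
  - have h'E := eqP hh'.
    apply: (lt_case h' h); last by rewrite h'E.
      by rewrite /paired h'E -surjective_pairing.
    by rewrite eq_sym.
  - by have := valP h; rewrite /= eq_h e_irr.
rewrite (bigD1 h) //= (bigD1 h') //= eprE (negPf neq).
by rewrite mul0r !mul0r.
Qed.

Variable r : 'I_n -> half_edge e.
Hypotheses (r_own : forall i, (val (r i)).1 = i) (e_sym : symmetric e)
  (e_conn : forall i j, connect e i j).
Definition ref_qubit (i : 'I_n) : Q := inl (r i).

Lemma owner_ref i : owner (ref_qubit i) = i.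
Proof. exact: r_own. Qed.

(** The halves of a pair agree with each other and with their owners' reference qubits, so the
    reference bits of neighbours agree; paths propagate this. *)
Lemma pairs_agree_rigid (s : cfg Q) :
    pairs_agree s -> (forall q, s q = s (ref_qubit (owner q))) ->
  forall q q', s q = s q'.
Proof.
move=> /pairs_agreeP agr s_own q q'; rewrite (s_own q) (s_own q').
have step i j : e i j -> s (ref_qubit i) = s (ref_qubit j).
  move=> eij; have eji : e j i by rewrite e_sym.
  pose h : half_edge e := exist _ (i, j) eij.
  pose h' : half_edge e := exist _ (j, i) eji.
  by rewrite -(s_own (half h)) -(s_own (half h')); apply: agr; apply: eqxx.
have /connectP[p + ->] := e_conn (owner q) (owner q').
by elim: p (owner q) => //= j p IHp i /andP[/step -> /IHp].
Qed.

End Pairs.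

(** * Qubit count, choice of reference qubits, and the theorem *)

Lemma card_qubit n (e : rel 'I_n) :
  symmetric e -> irreflexive e -> acyclic e ->
  (#|qubit e (fun=> 0%N)| <= 2 * n)%N.
Proof.
move=> e_sym e_irr e_acyc.
have := acyclic_card_edges e_sym e_irr e_acyc; rewrite card_ord.
apply: leq_trans.
rewrite card_sum card_sig [X in (_ + X)%N]eq_card0 ?addn0 // => -[i []] //.
Qed.

(** Take the first edge of a path from [i] to some other agent. *)
Lemma half_edge_at n (e : rel 'I_n) : (2 <= n)%N ->
  (forall i j, connect e i j) ->
  forall i, exists h : half_edge e, (val h).1 == i.
Proof.
move=> n_ge2 e_conn i.
have [j ji] : exists j : 'I_n, j != i.
  have : (0 < #|[set~ i]|)%N by rewrite cardsC1 card_ord -subn1 subn_gt0.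
  by case/card_gt0P=> j; rewrite !inE; exists j.
have /connectP[[|k p]] := e_conn i j; first by move=> _ ij; rewrite ij eqxx in ji.
by case/andP=> eik _ _; exists (exist _ (i, k) eik) => /=.
Qed.

Theorem theorem3p1 :
  exists c : nat,
  forall (R : realType) (n : nat) (e : rel 'I_n),
    (2 <= n)%N -> is_tree e ->
    exists (anc : 'I_n -> nat) (P : protocol R[i] (@owner n e anc))
           (out : 'I_n -> qubit e anc),
      [/\ forall i : 'I_n, owner (out i) = i,
          (comm_cost P <= c * n)%N
        & forall psi : state R[i] (qubit e anc),
            reaches P (fun _ => [::]) (init_state R[i] e anc) psi ->
            shares_cat_state out psi].
Proof.
exists 2%N => R n e n_ge2 [e_sym e_irr e_conn e_acyc].
have r_ex := half_edge_at n_ge2 e_conn.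
pose r i := xchoose (r_ex i).
have r_own i : (val (r i)).1 = i by apply/eqP; apply: xchooseP (r_ex i).
have own_ref := owner_ref r_own.
pose Q := qubit e (fun=> 0%N).
exists (fun=> 0%N), (merging R[i] own_ref (@pairs_agree n e) (enum Q) [::]),
  (ref_qubit r); split=> [//||psi].
  by rewrite merging_cost -cardE card_qubit.
have [a init_a] := init_uniform R[i] e_irr.
have initE : uniform_on a
    [pred s | pairs_agree s && consistent (@owner n e _) (ref_qubit r) [::] s]
    (init_state R[i] e (fun=> 0%N)).
  by move=> s; rewrite init_a /= andbT.
apply: merging_reaches initE.
- exact: pairs_agree_add.
- exact: (pairs_agree_rigid e_sym e_conn).
- exact: pairs_agree_const.
- exact: ltnW.
- by move=> q; rewrite mem_enum.
Qed.
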